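(* Let $\ell\ge1$. (1) For $p=2\ell$: $h_{2\ell,2}=\alpha(G_{2\ell})$, where $\alpha(G_{2\ell})$ is the independence number of the Cayley graph $G_{2\ell}=\mathrm{Cay}(\mathbb Z_2^{2\ell},S_{2\ell})$, $S_{2\ell}=\{e_1,\dots,e_{2\ell},\,e_1+\dots+e_{2\ell}\}$. (2) For $p=2\ell+1$: $h_{2\ell+1,2}=\alpha(G_{2\ell+1})$, where $\alpha(G_{2\ell+1})$ is the independence number of the Cayley graph $G_{2\ell+1}=\mathrm{Cay}(\mathbb Z_2^{2\ell+1},S_{2\ell+1})$, $S_{2\ell+1}=\{e_1,\dots,e_{2\ell+1},\,e_1+\dots+e_{2\ell}\}$.
   Context: For integers $1\le r\le p$, $h_{p,r}$ denotes the maximal number of binary words of length $p$ such that every two words of the set match in at least $r$ spots. $e_1,\dots,e_p$ is the standard basis of $\mathbb Z_2^p$. $\mathrm{Cay}(\mathbb Z_2^p,S)$ is the graph with vertex set $\mathbb Z_2^p$ in which $u,v$ are adjacent iff $u-v\in S$. The independence number $\alpha(G)$ is the maximal number of vertices of $G$ no two of which are adjacent. *)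

(* Defs.v *)
From mathcomp Require Import all_boot all_order all_algebra.

Set Implicit Arguments.
Unset Strict Implicit.
Unset Printing Implicit Defensive.

Import GRing.Theory.
Local Open Scope ring_scope.

Definition num_matches (p : nat) (u v : p.-tuple bool) : nat :=
  #|[set i : 'I_p | tnth u i == tnth v i]|.

Definition matching_family (p r : nat) (A : {set p.-tuple bool}) : bool :=
  [forall u in A, forall v in A, (u != v) ==> (r <= num_matches u v)%N].

(* Meant for 1 <= r <= p. *)
Definition h (p r : nat) : nat :=
  \max_(A : {set p.-tuple bool} | matching_family r A) #|A|.

(* A graph is given by its adjacency relation. *)
Definition independent (T : finType) (e : rel T) (A : {set T}) : bool :=
  [forall u in A, forall v in A, (u != v) ==> ~~ e u v].

Definition alpha (T : finType) (e : rel T) : nat :=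
  \max_(A : {set T} | independent e A) #|A|.

Definition Cay (V : finZmodType) (S : {set V}) : rel V :=
  fun u v => u - v \in S.

Definition std_basis (p : nat) (i : 'I_p) : 'rV['Z_2]_p := delta_mx 0 i.

Definition S_even (l : nat) : {set 'rV['Z_2]_(2 * l)} :=
  [set std_basis i | i : 'I_(2 * l)] :|: [set \sum_(i < 2 * l) std_basis i].

(* The extra generator omits the last basis vector. *)
Definition S_odd (l : nat) : {set 'rV['Z_2]_(2 * l + 1)} :=
  [set std_basis i | i : 'I_(2 * l + 1)]
    :|: [set \sum_(i < 2 * l + 1 | (i < 2 * l)%N) std_basis i].

(* Main.v *)
Require Import Defs.
From mathcomp Require Import all_boot all_order all_algebra.

(** Identify words with vectors of [Z_2^p].  Two words match in fewer than two
    spots iff their difference lies in [D = {1, 1 - e_1, ..., 1 - e_p}], where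
    [1] is the all-ones vector, so [h p 2] is the independence number of
    [Cay(Z_2^p, D)].  In both parities a linear automorphism of [Z_2^p] maps [D]
    onto the given connection set, hence is an isomorphism of Cayley graphs:
    - for [p = 2l], [x |-> x + (x_1 + ... + x_p) 1];
    - for [p = 2l+1], the map with [e_i |-> e_i + e_p] for [i < p] and
      [e_p |-> 1]. *)

Set Implicit Arguments.
Unset Strict Implicit.
Unset Printing Implicit Defensive.

Import GRing.Theory.
Local Open Scope ring_scope.

(** An injection that reflects adjacency sends an independent set to an independent set of the same
    size. *)
Lemma leq_alpha_inj (T U : finType) (e : rel T) (e' : rel U) (f : T -> U) :
    injective f -> (forall u v, u != v -> e' (f u) (f v) -> e u v) ->
  (alpha e <= alpha e')%N.
Proof.
move=> f_inj fe; apply/bigmax_leqP => A indA.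
rewrite -(card_imset A f_inj); apply: (leq_bigmax_cond (F := fun B : {set U} => #|B|)).
apply/forall_inP => _ /imsetP[u uA ->]; apply/forall_inP => _ /imsetP[v vA ->].
rewrite (inj_eq f_inj); apply/implyP => neq_uv.
move/forall_inP: indA => /(_ u uA)/forall_inP/(_ v vA); rewrite neq_uv /=.
by apply: contra; apply: fe.
Qed.

Lemma alpha_iso (T U : finType) (e : rel T) (e' : rel U) (f : T -> U) :
    bijective f -> (forall u v, u != v -> e' (f u) (f v) = e u v) ->
  alpha e = alpha e'.
Proof.
case=> g fK gK fe; apply/eqP; rewrite eqn_leq; apply/andP; split.
  by apply: (leq_alpha_inj (can_inj fK)) => u v /fe->.
apply: (leq_alpha_inj (can_inj gK)) => u v neq_uv.
by rewrite -fe ?gK // (inj_eq (can_inj gK)).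
Qed.

(** By finiteness [g] is an automorphism of the group, and [u - v] lies in [S] iff [g u - g v] lies
    in the image of [S]. *)
Lemma alpha_Cay_imset (V : finZmodType) (S : {set V}) (g : V -> V) :
    {morph g : u v / u - v} -> injective g ->
  alpha (Cay S) = alpha (Cay [set g x | x in S]).
Proof.
move=> gB g_inj; apply: (alpha_iso (injF_bij g_inj)) => u v _.
by rewrite /Cay -gB mem_imset.
Qed.

Lemma inj_of_ker (V W : zmodType) (g : V -> W) :
    {morph g : u v / u - v} -> (forall x, g x = 0 -> x = 0) -> injective g.
Proof.
move=> gB g0 u v guv; apply/eqP; rewrite -subr_eq0; apply/eqP/g0.
by rewrite gB guv subrr.
Qed.

Lemma Z2_addrr (x : 'Z_2) : x + x = 0.
Proof. by case: x => [[|[|n]]] // i; apply: val_inj. Qed.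

Lemma Z2_oppr (x : 'Z_2) : - x = x.
Proof. by apply/eqP; rewrite eq_sym -addr_eq0 Z2_addrr. Qed.

Lemma Z2_neq0 (x : 'Z_2) : x != 0 -> x = 1.
Proof. by case: x => [[|[|n]]] // i _; apply: val_inj. Qed.

Lemma Z2_mulrn_double (x : 'Z_2) (l : nat) : x *+ (2 * l) = 0.
Proof. by rewrite mulrnA mulr2n Z2_addrr mul0rn. Qed.

Lemma Z2_mulrn_doubleS (x : 'Z_2) (l : nat) : x *+ (2 * l + 1) = x.
Proof. by rewrite mulrnDr Z2_mulrn_double add0r. Qed.

Definition near_ones (p : nat) : {set 'rV['Z_2]_p} :=
  [set const_mx 1 - std_basis i | i : 'I_p] :|: [set const_mx 1].

Lemma near_onesP (p : nat) (w : 'rV['Z_2]_p) :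
  (#|[set i | w ord0 i == 0%R]| < 2)%N = (w \in near_ones p).
Proof.
rewrite !inE; apply/idP/orP => [|[/imsetP[i _ ->]|/eqP->]]; last 2 first.
- rewrite ltnS; apply: leq_trans (eq_leq (cards1 i)); apply: subset_leq_card.
  apply/subsetP=> j; rewrite !inE !mxE eqxx /=.
  by case: (j == i); rewrite // subr0.
- by rewrite (_ : [set _ | _] = set0) ?cards0 //; apply/setP=> j; rewrite !inE mxE.
(* Over ['Z_2] a row is determined by its zeros: a single zero at [i] gives [1 - e_i], no zero gives
   the all-ones row. *)
rewrite ltnS leq_eqVlt ltnS leqn0 => /orP[/cards1P[i Ei]|].
  left; apply/imsetP; exists i => //; apply/rowP => j; rewrite !mxE eqxx /=.
  move/setP: Ei => /(_ j); rewrite !inE.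
  case: (j == i) => [/eqP->|/negbT/Z2_neq0->]; first by rewrite subrr.
  by rewrite subr0.
rewrite cards_eq0 => /eqP E0; right; apply/eqP/rowP=> j; rewrite mxE.
by apply: Z2_neq0; move/setP: E0 => /(_ j); rewrite !inE => ->.
Qed.

Definition word_row (p : nat) (u : p.-tuple bool) : 'rV['Z_2]_p :=
  \row_i (tnth u i)%:R.

Lemma word_row_eq (p : nat) (u v : p.-tuple bool) (i : 'I_p) :
  ((word_row u - word_row v) ord0 i == 0) = (tnth u i == tnth v i).
Proof. by rewrite !mxE; case: (tnth u i); case: (tnth v i). Qed.

Lemma word_row_bij (p : nat) : bijective (@word_row p).
Proof.
apply: inj_card_bij => [u v uv|].
  by apply: eq_from_tnth => i; apply/eqP; rewrite -word_row_eq uv subrr mxE.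
by rewrite card_mx mul1n card_tuple card_bool card_ord.
Qed.

(** A matching family is an independent set for the relation of having fewer than two matches.
    Matches are the zeros of the difference of rows, so [word_row] carries this relation to the
    Cayley graph. *)
Lemma h2_alpha_Cay (p : nat) : h p 2 = alpha (Cay (near_ones p)).
Proof.
rewrite -(@alpha_iso _ _ (fun u v => num_matches u v < 2)%N _ _ (word_row_bij p)).
  rewrite /h /alpha; apply: eq_bigl => A; rewrite /matching_family /independent.
  apply: eq_forallb_in => u _; apply: eq_forallb_in => v _.
  by rewrite -leqNgt.
move=> u v _; rewrite /Cay -near_onesP /num_matches; congr (_ < _)%N.
by apply: eq_card => i; rewrite !inE word_row_eq.
Qed.

Lemma sum_std_basis (p : nat) (P : pred 'I_p) :
  \sum_(i | P i) std_basis i = \row_j (P j)%:R.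
Proof.
apply/rowP => j; rewrite summxE mxE big_mkcond (bigD1 j) //= big1 => [|i neq_ij].
  by rewrite addr0; case: (P j); rewrite // mxE !eqxx.
by case: (P i); rewrite // mxE eqxx /= eq_sym (negPf neq_ij).
Qed.

Lemma sum_std_basis_coord (p : nat) (i : 'I_p) :
  \sum_j std_basis i ord0 j = 1.
Proof.
rewrite (bigD1 i) //= big1 => [|j neq_ji]; last by rewrite mxE (negPf neq_ji) andbF.
by rewrite mxE !eqxx addr0.
Qed.

Section Even.

Variable l : nat.

Definition even_map (x : 'rV['Z_2]_(2 * l)) : 'rV['Z_2]_(2 * l) :=
  x + const_mx (\sum_j x ord0 j).

Lemma even_mapB : {morph even_map : u v / u - v}.
Proof.
move=> u v; apply/rowP => i; rewrite !mxE.
under eq_bigr do rewrite !mxE.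
by rewrite sumrB addrACA opprD.
Qed.

Lemma even_map_inj : injective even_map.
Proof.
apply: (inj_of_ker even_mapB) => x /rowP gx0.
(* A kernel row is constant, so its coordinate sum has [2 * l] equal terms and vanishes; but that
   sum is also the constant itself. *)
have x_sum i : x ord0 i = \sum_j x ord0 j.
  by apply/eqP; move/eqP: (gx0 i); rewrite !mxE addr_eq0 Z2_oppr.
apply/rowP=> i; rewrite mxE x_sum.
under eq_bigr do rewrite x_sum.
by rewrite sumr_const card_ord Z2_mulrn_double.
Qed.

Lemma even_map_ones : even_map (const_mx 1) = const_mx 1.
Proof.
apply/rowP => i; rewrite !mxE.
under eq_bigr do rewrite mxE.
by rewrite sumr_const card_ord Z2_mulrn_double addr0.
Qed.

(** The all-ones row is fixed and [e_i] goes to [e_i + 1], so the difference is [- e_i = e_i]. *)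
Lemma even_map_ones_sub (i : 'I_(2 * l)) :
  even_map (const_mx 1 - std_basis i) = std_basis i.
Proof.
rewrite even_mapB even_map_ones /even_map sum_std_basis_coord.
by apply/rowP => j; rewrite !mxE opprD addrCA subrr addr0 Z2_oppr.
Qed.

Lemma even_map_near_ones : [set even_map x | x in near_ones (2 * l)] = S_even l.
Proof.
rewrite imsetU imset_set1 even_map_ones -imset_comp /S_even sum_std_basis.
congr (_ :|: [set _]); first by apply: eq_imset => i; apply: even_map_ones_sub.
by apply/rowP => j; rewrite !mxE.
Qed.

End Even.

Section Odd.

Variable l : nat.

Fact odd_last_subproof : (2 * l < 2 * l + 1)%N. Proof. by rewrite addn1. Qed.

Definition odd_last : 'I_(2 * l + 1) := Ordinal odd_last_subproof.

Lemma lt_odd_last (i : 'I_(2 * l + 1)) : (i < 2 * l)%N = (i != odd_last).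
Proof. by rewrite -val_eqE /= ltn_neqAle -ltnS -[(2 * l).+1]addn1 ltn_ord andbT. Qed.

(** Coordinate form of the map given on the basis: every [e_j] contributes to the last coordinate,
    and [e_p], with [p] the index [odd_last], contributes to all the others as well. *)
Definition odd_map (x : 'rV['Z_2]_(2 * l + 1)) : 'rV['Z_2]_(2 * l + 1) :=
  \row_i if i == odd_last then \sum_j x ord0 j
         else x ord0 i + x ord0 odd_last.

Lemma odd_mapB : {morph odd_map : u v / u - v}.
Proof.
move=> u v; apply/rowP => i; rewrite !mxE; case: eqP => _.
  by under eq_bigr do rewrite !mxE; rewrite sumrB.
by rewrite addrACA opprD.
Qed.

Lemma odd_map_inj : injective odd_map.
Proof.
apply: (inj_of_ker odd_mapB) => x /rowP gx0.
(* Again a kernel row is constant; now the last coordinate of its image is a sum of [2 * l + 1]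
   equal terms, which is the constant itself. *)
have x_last i : x ord0 i = x ord0 odd_last.
  have [->//|neq_i] := eqVneq i odd_last; apply/eqP; move/eqP: (gx0 i).
  by rewrite !mxE (negPf neq_i) addr_eq0 Z2_oppr.
apply/rowP=> i; rewrite mxE x_last; move: (gx0 odd_last); rewrite !mxE eqxx.
under eq_bigr do rewrite x_last.
by rewrite sumr_const card_ord Z2_mulrn_doubleS.
Qed.

Lemma odd_map_ones : odd_map (const_mx 1) = std_basis odd_last.
Proof.
apply/rowP => i; rewrite !mxE eqxx /=; case: eqP => _; last exact: Z2_addrr.
under eq_bigr do rewrite mxE.
by rewrite sumr_const card_ord Z2_mulrn_doubleS.
Qed.

(** Subtract the image of [e_i] from [e_p], the image of the all-ones row: [e_p - (e_i + e_p) = e_i]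
    for [i] not last, and [e_p - 1] is the sum of the other basis vectors for [i] last. *)
Lemma odd_map_ones_sub (i : 'I_(2 * l + 1)) :
  odd_map (const_mx 1 - std_basis i) =
    if i == odd_last then \sum_(j < 2 * l + 1 | (j < 2 * l)%N) std_basis j
    else std_basis i.
Proof.
rewrite odd_mapB odd_map_ones sum_std_basis; apply/rowP => j.
rewrite !mxE eqxx /= sum_std_basis_coord.
have [->|neq_i] := eqVneq i odd_last; rewrite !mxE ?eqxx /=.
  rewrite lt_odd_last; case: eqP => _ /=; first by rewrite subrr.
  by rewrite sub0r add0r Z2_oppr.
have [->|_] := eqVneq j odd_last.
  by rewrite subrr eq_sym (negPf neq_i).
by rewrite addr0 sub0r Z2_oppr.
Qed.

(** Unlike in the even case, the extra generator comes from [1 - e_p], while the all-ones row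
    supplies the basis vector [e_p]. *)
Lemma odd_map_near_ones : [set odd_map x | x in near_ones (2 * l + 1)] = S_odd l.
Proof.
rewrite imsetU imset_set1 odd_map_ones -imset_comp /S_odd.
apply/setP => w; rewrite !inE.
apply/orP/orP => [[/imsetP[i _ ->]|/eqP->]|[/imsetP[i _ ->]|/eqP->]].
- rewrite /= odd_map_ones_sub; case: eqP => _; first by right.
  by left; apply: imset_f.
- by left; apply: imset_f.
- have [->|neq_i] := eqVneq i odd_last; [by right | left].
  by apply/imsetP; exists i; rewrite //= odd_map_ones_sub (negPf neq_i).
- by left; apply/imsetP; exists odd_last; rewrite //= odd_map_ones_sub eqxx.
Qed.

End Odd.

Theorem theorem6p2 (l : nat) (hl : (1 <= l)%N) :
  h (2 * l) 2 = alpha (Cay (S_even l)) /\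
  h (2 * l + 1) 2 = alpha (Cay (S_odd l)).
Proof.
rewrite !h2_alpha_Cay -even_map_near_ones -odd_map_near_ones; split.
  exact: (alpha_Cay_imset _ (@even_mapB l) (@even_map_inj l)).
exact: (alpha_Cay_imset _ (@odd_mapB l) (@odd_map_inj l)).
Qed.
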